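(* Let $n^*_1,n^*_2\ge 1$ be integers, $n^*=n^*_1+n^*_2$. Let $X_1,\dots,X_{n^*}$ be dependent nonnegative random variables sharing an Archimedean copula with generator $\psi_1$ (with $\phi_1=\psi_1^{-1}$), where $X_i$ has distribution function $x\mapsto F_1(\lambda_1x)$ for $i=1,\dots,n^*_1$ and $X_j$ has distribution function $x\mapsto F_2(\lambda_2x)$ for $j=n^*_1+1,\dots,n^*$, with $\lambda_1,\lambda_2>0$. Let $Y_1,\dots,Y_{n^*}$ be dependent nonnegative random variables sharing an Archimedean copula with generator $\psi_2$ (with $\phi_2=\psi_2^{-1}$), where $Y_i$ has distribution function $x\mapsto F_1(\mu_1x)$ for $i=1,\dots,n^*_1$ and $Y_j$ has distribution function $x\mapsto F_2(\mu_2x)$ for $j=n^*_1+1,\dots,n^*$, with $\mu_1,\mu_2>0$. Let $X_{n^*:n^*}(n^*_1,n^*_2)=\max_i X_i$ and $Y_{n^*:n^*}(n^*_1,n^*_2)=\max_i Y_i$. Suppose $\phi_2\circ\psi_1$ is super-additive, $\psi_1$ or $\psi_2$ is log-convex, and $\tilde r_1$ or $\tilde r_2$ is decreasing. Suppose further that either (a) $\tilde r_1(x)\ge \tilde r_2(x)$ for all $x>0$, $n^*_1\ge n^*_2$, and $\boldsymbol\lambda=(\lambda_1,\lambda_2),\boldsymbol\mu=(\mu_1,\mu_2)\in\mathcal E_+$; or (b) $\tilde r_1(x)\le \tilde r_2(x)$ for all $x>0$, $n^*_1\le n^*_2$, and $\boldsymbol\lambda,\boldsymbol\mu\in\mathcal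 D_+$. Then $$(\underbrace{\lambda_1,\dots,\lambda_1}_{n^*_1},\underbrace{\lambda_2,\dots,\lambda_2}_{n^*_2})\succeq^{w}(\underbrace{\mu_1,\dots,\mu_1}_{n^*_1},\underbrace{\mu_2,\dots,\mu_2}_{n^*_2})\ \Longrightarrow\ Y_{n^*:n^*}(n^*_1,n^*_2)\le_{st}X_{n^*:n^*}(n^*_1,n^*_2).$$
   Context: Archimedean copula: a generator is a continuous nonincreasing $\psi:[0,\infty)\to[0,1]$ with $\psi(0)=1$, $\psi(\infty)=0$, which is $n$-monotone so that it generates an $n$-dimensional copula; $\phi=\psi^{-1}$ is its (right-continuous) inverse. Random variables $Z_1,\dots,Z_m$ with marginal distribution functions $G_1,\dots,G_m$ share an Archimedean copula with generator $\psi$ if $P(Z_1\le z_1,\dots,Z_m\le z_m)=\psi\big(\sum_{i=1}^m\phi(G_i(z_i))\big)$. $F_1,F_2$ are absolutely continuous baseline distribution functions of nonnegative random variables with densities $f_1,f_2$; $\tilde r_k=f_k/F_k$ is the reversed hazard rate of $F_k$. A function $g$ is super-additive if $g(x)+g(y)\le g(x+y)$ for all $x,y$ in its domain. $\mathcal E_+=\{(x_1,x_2):0<x_1\le x_2\}$, $\mathcal D_+=\{(x_1,x_2):x_1\ge x_2>0\}$. For vectors $\boldsymbol a,\boldsymbol b\in\mathbb R^k$ with increasingly ordered coordinates $a_{(1)}\le\dots\le a_{(k)}$, $b_{(1)}\le\dots\le b_{(k)}$: $\boldsymbol a\succeq^{w}\boldsymbol b$ means $\sum_{i=1}^l b_{(i)}\ge\sum_{i=1}^l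 a_{(i)}$ for all $l=1,\dots,k$. $U\le_{st}V$ means $P(U>x)\le P(V>x)$ for all $x$. ''Increasing/decreasing'' mean nondecreasing/nonincreasing. *)

(* Defs.v *)
From HB Require Import structures.
From mathcomp Require Import all_boot all_order all_algebra.
From mathcomp Require Import all_classical all_reals all_analysis.
Set Implicit Arguments. Unset Strict Implicit. Unset Printing Implicit Defensive.
Import Order.TTheory GRing.Theory Num.Theory.
Import numFieldNormedType.Exports.
Local Open Scope classical_set_scope.
Local Open Scope ring_scope.

(* n-monotonicity on (0, +oo) (McNeil--Neslehova): for n >= 2, psi is
   differentiable up to order n-2 on (0,oo), (-1)^k psi^(k) >= 0 for
   k = 0..n-2, and (-1)^(n-2) psi^(n-2) is nonincreasing and convex on (0,oo). *)
Definition n_monotone {R : realType} (n : nat) (psi : R -> R) : Prop :=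
  [/\ (forall k, (k < n - 2)%N -> forall x, 0 < x -> derivable (derive1n k psi) x 1),
      (forall k, (k <= n - 2)%N -> forall x, 0 < x -> 0 <= (-1) ^+ k * derive1n k psi x),
      (forall x y, 0 < x -> x <= y ->
         (-1) ^+ (n - 2) * derive1n (n - 2) psi y <= (-1) ^+ (n - 2) * derive1n (n - 2) psi x)
    & (forall x y t, 0 < x -> 0 < y -> 0 <= t -> t <= 1 ->
         (-1) ^+ (n - 2) * derive1n (n - 2) psi (t * x + (1 - t) * y) <=
         t * ((-1) ^+ (n - 2) * derive1n (n - 2) psi x) +
         (1 - t) * ((-1) ^+ (n - 2) * derive1n (n - 2) psi y))].

(* Archimedean generator for dimension n, psi : [0,oo) -> [0,1]
   (given as a function on R; only its values on [0,oo) matter). *)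
Definition arch_generator {R : realType} (n : nat) (psi : R -> R) : Prop :=
  [/\ {within `[0, +oo[, continuous psi} /\
      (forall x y, 0 <= x -> x <= y -> psi y <= psi x),
      (forall x, 0 <= x -> 0 <= psi x <= 1),
      psi 0 = 1,
      psi x @[x --> +oo] --> 0
    & n_monotone n psi].

(* phi = psi^{-1}: phi t = inf {x >= 0 | psi x <= t}, valued in the extended
   reals (phi 0 = +oo when psi is strict, i.e. inf of the empty set). *)
Definition gen_inv {R : realType} (psi : R -> R) (t : R) : \bar R :=
  ereal_inf [set x%:E | x in [set x : R | 0 <= x /\ psi x <= t]].

(* psi extended to [0, +oo], psi(+oo) = 0 (the value at -oo is irrelevant). *)
Definition gen_ext {R : realType} (psi : R -> R) (e : \bar R) : R :=
  match e with
  | x%:E => psi x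
  | +oo%E => 0
  | -oo%E => 1
  end.

Definition shares_arch_copula {R : realType} (d : measure_display)
  (T : measurableType d) (P : probability T R) (m : nat)
  (Z : 'I_m -> {RV P >-> R}) (G : 'I_m -> R -> R) (psi : R -> R) : Prop :=
  forall z : 'I_m -> R,
    P [set w | forall i, Z i w <= z i] =
    (gen_ext psi (\sum_(i < m) gen_inv psi (G i (z i)))%E)%:E.

Definition abs_cont_cdf {R : realType} (F f : R -> R) : Prop :=
  [/\ measurable_fun setT f,
      (forall x, 0 <= f x),
      (\int[lebesgue_measure]_(t in setT) (f t)%:E = 1)%E,
      (forall x, (F x)%:E = (\int[lebesgue_measure]_(t in [set t : R | (t <= x)%R]) (f t)%:E)%E)
    & (forall x, x < 0 -> F x = 0)].

Definition rev_hazard {R : realType} (F f : R -> R) (x : R) : R := f x / F x.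

Definition super_additive {R : realType} (g : R -> \bar R) : Prop :=
  forall x y, 0 <= x -> 0 <= y -> (g x + g y <= g (x + y)%R)%E.

Definition log_convex {R : realType} (psi : R -> R) : Prop :=
  forall x y t, 0 <= x -> 0 <= y -> 0 < t < 1 ->
    psi (t * x + (1 - t) * y) <= psi x `^ t * psi y `^ (1 - t).

(* decreasing (nonincreasing) on the part of (0,oo) where it is defined, F > 0 *)
Definition rh_decreasing {R : realType} (F f : R -> R) : Prop :=
  forall x y, 0 < x -> x <= y -> 0 < F x -> rev_hazard F f y <= rev_hazard F f x.

Definition wsubmaj {R : realType} (a b : seq R) : Prop :=
  size a = size b /\
  forall l, (l <= size a)%N ->
    \sum_(i < l) (sort <=%R a)`_i <= \sum_(i < l) (sort <=%R b)`_i.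

Definition st_le {R : realType} (d d' : measure_display)
  (T : measurableType d) (T' : measurableType d')
  (P : probability T R) (P' : probability T' R) (U : T -> R) (V : T' -> R) : Prop :=
  forall x : R, (P [set w | (x < U w)%R] <= P' [set w | (x < V w)%R])%E.

(* maximum of Z_0..Z_{m-1} (nonnegative variables, so seed 0 is harmless) *)
Definition maxRV {R : realType} (m : nat) (T : Type) (Z : 'I_m -> T -> R) (w : T) : R :=
  \big[Order.max/0]_(i < m) Z i w.

(* Main.v *)
Require Import Defs.
From HB Require Import structures.
From mathcomp Require Import all_boot all_order all_algebra.
From mathcomp Require Import all_classical all_reals all_analysis.
From mathcomp Require Import measurable_realfun ring lra.
Set Implicit Arguments. Unset Strict Implicit. Unset Printing Implicit Defensive.
Import Order.TTheory GRing.Theory Num.Theory.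
Import numFieldNormedType.Exports.
Local Open Scope classical_set_scope.
Local Open Scope ring_scope.

(** Super-additivity of [phi2 \o psi1] gives
    [psi1 (sum_i phi1 u_i) <= psi2 (sum_i phi2 u_i)], so it suffices to compare the
    two scale vectors under the one generator [psi] that is log-convex. By symmetry
    let [r1 >= r2], hence [F1 <= F2]. The only nontrivial case is
    [l1 <= m1 <= m2 < l2] with [n2 (l2 - m2) <= n1 (m1 - l1)]. Monotonicity of [r1] or
    [r2] provides a constant [K] with [r1 >= K] on [[l1 x, m1 x]] and [r2 <= K] on
    [[m2 x, l2 x]], which compares the increments of [ln F1] and [ln F2]; convexity of
    [ln \o psi] transfers this comparison to [phi \o F1] and [phi \o F2].

    As [F1], [F2] are only absolutely continuous and [psi] need not be differentiable,
    derivatives are avoided: monotonicity of a function [D] is deduced from bounds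
    [D v - D u <= (A v - A u) * (B v - B u)] on its increments. *)

(** * Monotonicity from second-order bounds on increments *)

(** Summing the bounds over a subdivision on which [B] grows by at most [e] per piece gives
    [D b - D a <= e * (A b - A a)], with [e] arbitrarily small. *)
Lemma nonincreasing_of_second_order (R : realType) (A B D : R -> R) (a b : R) :
  a <= b -> {within `[a, b], continuous B} ->
  (forall u v, a <= u -> u <= v -> v <= b -> A u <= A v) ->
  (forall u v, a <= u -> u <= v -> v <= b -> B u <= B v) ->
  (forall u v, a <= u -> u <= v -> v <= b ->
    D v - D u <= (A v - A u) * (B v - B u)) ->
  D b <= D a.
Proof.
move=> ab cB ndA ndB hD.
(* Subdivide [[c, b]] so that [B] grows by at most [e] on each piece. *)
have step (e : R) (n : nat) : 0 < e -> forall c, a <= c -> c <= b ->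
    B b - B c <= n%:R * e -> D b - D c <= e * (A b - A c).
  move=> e0; elim: n => [|n ih] c ac cb hB.
    apply: (le_trans (hD _ _ ac cb (lexx b))).
    have := ndA _ _ ac cb (lexx b); have := ndB _ _ ac cb (lexx b); nra.
  have [small|large] := leP (B b - B c) e.
    apply: (le_trans (hD _ _ ac cb (lexx b))).
    have := ndA _ _ ac cb (lexx b); nra.
  have Bcb := ndB _ _ ac cb (lexx b).
  (* The first piece ends where [B] has grown by exactly [e]; the growth left on [[m, b]] is then at
     most [n%:R * e]. *)
  have [||m + Bm] := @IVT _ B c b (B c + e) cb.
  - apply: continuous_subspaceW cB => x /=; rewrite !in_itv/= => /andP[cx ->].
    by rewrite (le_trans ac cx).
  - by rewrite min_l // max_r //; apply/andP; split; lra.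
  rewrite in_itv/= => /andP[cm mb]; have am := le_trans ac cm.
  have h1 := hD _ _ ac cm mb; have h2 := ndA _ _ ac cm mb.
  have h3 : D b - D m <= e * (A b - A m).
    apply: ih => //; rewrite Bm; move: hB; rewrite -natr1; lra.
  rewrite Bm in h1; lra.
apply/ler_addgt0Pr => e e0.
have Aab := ndA _ _ (lexx a) ab (lexx b).
(* The [+ 1] keeps the divisor positive when [A] is constant. *)
have c0 : 0 < A b - A a + 1 by lra.
have d0 : 0 < e / (A b - A a + 1) by rewrite divr_gt0.
have := step _ (Num.Def.archi_bound ((B b - B a) / (e / (A b - A a + 1)))) d0 a (lexx a) ab.
have Bab := ndB _ _ (lexx a) ab (lexx b).
rewrite -ler_pdivrMr// => /(_ (ltW (archi_boundP (divr_ge0 _ (ltW d0))))) => h.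
have {h} : D b - D a <= e / (A b - A a + 1) * (A b - A a) by apply: h; lra.
rewrite mulrAC -mulrA => h.
have : (A b - A a) / (A b - A a + 1) <= 1 by rewrite ler_pdivrMr //; lra.
nra.
Qed.

(** * Primitives of nonnegative functions *)

(** Phrased by increments, so that it covers both distribution functions and the identity, whose
    growths are compared by integrating pointwise inequalities. *)
Definition primitive_of {R : realType} (g G : R -> R) : Prop :=
  [/\ measurable_fun setT g, (forall t, 0 <= g t) &
    forall u v, u <= v ->
      (G v - G u)%:E = (\int[lebesgue_measure]_(t in `]u, v]) (g t)%:E)%E].

Lemma primitive_compare (R : realType) (g h G H : R -> R) (a b u v : R) :
  primitive_of g G -> primitive_of h H -> 0 <= a -> 0 <= b -> u <= v ->
  (forall t, u < t <= v -> a * g t <= b * h t) ->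
  a * (G v - G u) <= b * (H v - H u).
Proof.
move=> [mg g0 iG] [mh h0 iH] a0 b0 uv gh.
have mE (k : R -> R) : measurable_fun setT k -> measurable_fun (`]u, v]%classic : set R) (EFin \o k).
  by move=> mk; apply/measurable_EFinP; apply: measurable_funTS.
rewrite -lee_fin !EFinM iG // iH // -!ge0_integralZl //; first last.
- by move=> x _; rewrite lee_fin.
- exact: mE.
- by move=> x _; rewrite lee_fin.
- exact: mE.
apply: ge0_le_integral => //.
- by move=> x _ /=; rewrite -EFinM lee_fin mulr_ge0.
- apply: (mE (fun t => a * g t)); exact: measurable_funM.
- apply: (mE (fun t => b * h t)); exact: measurable_funM.

Qed.

Lemma primitive_nd (R : realType) (g G : R -> R) (u v : R) :
  primitive_of g G -> u <= v -> G u <= G v.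
Proof.
move=> [_ g0 iG] uv; rewrite -subr_ge0 -lee_fin iG //.
by apply: integral_ge0 => x _; rewrite lee_fin.
Qed.

Lemma primitive_id (R : realType) : primitive_of (cst (1 : R)) id.
Proof.
split=> // u v uv.
have := integral_cst lebesgue_measure (measurable_itv `]u, v]) 1%:E.
rewrite mul1e /cst => ->.
apply/esym; apply: (etrans (lebesgue_measure_itv `]u, v])).
by rewrite /= lte_fin; case: ltgtP uv => // -> _; rewrite subrr.
Qed.

Lemma primitive_continuous (R : realType) (g G : R -> R) (a b : R) :
  primitive_of g G -> a <= b -> {within `[a, b], continuous G}.
Proof.
move=> [mg g0 iG] ab.
have ig : lebesgue_measure.-integrable `[a, b] (EFin \o g).
  apply/integrableP; split; first by apply/measurable_EFinP; apply: measurable_funTS.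
  under eq_integral do rewrite /= ger0_norm //.
  rewrite -integral_itv_obnd_cbnd; last first.
    by apply/measurable_EFinP; apply: measurable_funTS.
  by rewrite -iG // ltry.
have GE : {in `[a, b]%classic, (fun x => G a + \int[lebesgue_measure]_(t in `[a, x]) g t)%R =1 G}.
  move=> x; rewrite inE/= in_itv/= => /andP[ax _].
  rewrite /Rintegral -integral_itv_obnd_cbnd; last first.
    by apply/measurable_EFinP; apply: measurable_funTS.
  by rewrite -iG //=; ring.
apply: (subspace_eq_continuous GE) => x.
apply: cvgD; first exact: cvg_cst.
exact: (parameterized_integral_continuous ab ig).
Qed.

(** * Absolutely continuous distribution functions *)

Lemma abs_cont_cdf_primitive (R : realType) (F f : R -> R) :
  abs_cont_cdf F f -> primitive_of f F.
Proof.
move=> [mf f0 _ iF _]; split=> // u v uv.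
have mfE (A : set R) : measurable A -> measurable_fun A (EFin \o f).
  by move=> mA; apply/measurable_EFinP; apply: measurable_funTS.
have E : [set t : R | t <= v] = [set t : R | t <= u] `|` `]u, v]%classic.
  rewrite predeqE => t /=; rewrite in_itv/=.
  have [tu|ut] := leP t u; first by rewrite (le_trans tu uv); split => // _; left.
  by split => [tv|[//|]//]; right.
have := iF v; rewrite E ge0_integral_setU //=; first last.
- apply/disj_setPS => t [/= tu]; rewrite in_itv/= => /andP[ut _].
  by move: (lt_le_trans ut tu); rewrite ltxx.
- by move=> x _; rewrite lee_fin.
- by apply: mfE; rewrite -E -set_itvNyc; exact: measurable_itv.
- by rewrite -set_itvNyc; exact: measurable_itv.
rewrite -iF EFinB => ->.
by rewrite addeAC subee // add0e.
Qed.

Lemma abs_cont_cdf_ge0 (R : realType) (F f : R -> R) (x : R) : abs_cont_cdf F f -> 0 <= F x.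
Proof.
move=> [_ f0 _ iF _]; rewrite -lee_fin iF.
by apply: integral_ge0 => t _; rewrite lee_fin.
Qed.

Lemma abs_cont_cdf_le1 (R : realType) (F f : R -> R) (x : R) : abs_cont_cdf F f -> F x <= 1.
Proof.
move=> [mf f0 i1 iF _]; rewrite -lee_fin iF -i1.
apply: ge0_subset_integral => //.
- by rewrite -set_itvNyc; exact: measurable_itv.
- by apply/measurable_EFinP.
- by move=> t _; rewrite lee_fin.
Qed.

(** By monotone convergence [F n%:R], the integral over [S n], tends to the total mass 1. *)
Lemma cdf_sup1 (R : realType) (F f : R -> R) (e : R) :
  abs_cont_cdf F f -> e < 1 -> exists M : R, forall x, M <= x -> e < F x.
Proof.
move=> aF e1; have [mf f0 i1 iF _] := aF.
pose S (n : nat) : set R := [set t | t <= n%:R].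
have SU : \bigcup_i S i = setT.
  rewrite predeqE => t; split => // _; exists (Num.Def.archi_bound `|t|) => //=.
  by apply: (le_trans (ler_norm _)); exact/ltW/archi_boundP.
have ndS : nondecreasing_seq S.
  by move=> m n mn; apply/subsetPset => t /= /le_trans; apply; rewrite ler_nat.
have mS i : measurable (S i : set R).
  by rewrite /S -set_itvNyc; exact: measurable_itv.
have cv : (F n%:R)%:E @[n --> \oo] --> 1%:E.
  rewrite -i1 -SU; under eq_fun do rewrite iF.
  apply: ge0_nondecreasing_set_cvg_integral => //.
  - by move=> i; apply/measurable_EFinP; apply: measurable_funTS.
  - by move=> i x _; rewrite lee_fin.
have /fine_cvgP[_ {}cv] := cv.
have [N _ hN] : \forall n \near \oo, e < F n%:R by exact: (cvgr_gt _ cv).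
exists N%:R => x Nx; apply: (lt_le_trans (hN N (leqnn N))).
exact: (primitive_nd (abs_cont_cdf_primitive aF) Nx).
Qed.

(** * Reversed hazard rates and increments of [ln F] *)

Lemma lnB_le (R : realType) (x y : R) : 0 < x -> 0 < y -> ln y - ln x <= (y - x) / x.
Proof.
move=> x0 y0; rewrite -ln_div ?posrE // mulrBl divff ?gt_eqF //.
have yx0 : 0 < y / x by rewrite divr_gt0.
have := @le_ln1Dx R (y / x - 1); rewrite (addrC 1) subrK; apply; lra.
Qed.

Lemma cdf_nd (R : realType) (F f : R -> R) (u v : R) :
  abs_cont_cdf F f -> u <= v -> F u <= F v.
Proof. by move=> /abs_cont_cdf_primitive pF uv; exact: (primitive_nd pF uv). Qed.

(** From [K * F <= f], integration gives [K * F u * (v - u) <= F v - F u]. Dividing by [F v] instead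
    of [F u], as [lnB_le] requires, costs only a product of two increments. *)
Lemma ln_cdf_lower (R : realType) (F f : R -> R) (a b K : R) :
  abs_cont_cdf F f -> 0 < F a -> a <= b -> 0 <= K ->
  (forall t, a <= t <= b -> K <= rev_hazard F f t) ->
  K * (b - a) <= ln (F b) - ln (F a).
Proof.
move=> aF Fa ab K0 hK; have pF := abs_cont_cdf_primitive aF.
have pos t : a <= t -> 0 < F t by move=> /(cdf_nd aF); exact: lt_le_trans.
suff : K * b - ln (F b) <= K * a - ln (F a) by lra.
apply: (@nonincreasing_of_second_order R (fun t => F t / F a) (fun t => K * t)
  (fun t => K * t - ln (F t)) a b ab).
- by apply: continuous_subspaceT; exact: mulrl_continuous.
- by move=> u v au uv vb; rewrite ler_pM2r ?invr_gt0 //; exact: (cdf_nd aF uv).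
- by move=> u v au uv vb; rewrite ler_wpM2l.
move=> u v au uv vb.
have Fu := pos _ au; have Fv := pos _ (le_trans au uv).
have Fuv := cdf_nd aF uv; have Fav := cdf_nd aF (le_trans au uv).
have inc : K * F u * (v - u) <= 1 * (F v - F u).
  apply: (primitive_compare (primitive_id R) pF) => //; first by rewrite mulr_ge0 // ltW.
  move=> t /andP[ut tv]; rewrite mulr1 mul1r.
  have Ft := pos _ (le_trans au (ltW ut)).
  have := hK t; rewrite (le_trans au (ltW ut)) (le_trans tv vb) => /(_ isT).
  rewrite /rev_hazard ler_pdivlMr // => /(le_trans _); apply.
  by rewrite ler_wpM2l //; exact: (cdf_nd aF (ltW ut)).
have lnb := lnB_le Fv Fu.
have d0 : 0 <= K * (v - u) by rewrite mulr_ge0 // subr_ge0.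
have : K * (v - u) <= (K * (v - u) * (F v - F u) + (F v - F u)) / F v.
  by rewrite ler_pdivlMr //; nra.
have : (F v - F u) / F v <= (F v - F u) / F a.
  by rewrite ler_wpM2l ?subr_ge0 // lef_pV2 ?posrE.
nra.
Qed.

(** Here [f <= K * F] integrates to [F v - F u <= K * F v * (v - u)], and division by [F u] again
    leaves a second-order error. *)
Lemma ln_cdf_upper (R : realType) (F f : R -> R) (a b K : R) :
  abs_cont_cdf F f -> 0 < F a -> a <= b -> 0 <= K ->
  (forall t, a <= t <= b -> rev_hazard F f t <= K) ->
  ln (F b) - ln (F a) <= K * (b - a).
Proof.
move=> aF Fa ab K0 hK; have pF := abs_cont_cdf_primitive aF.
have pos t : a <= t -> 0 < F t by move=> /(cdf_nd aF); exact: lt_le_trans.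
suff : ln (F b) - K * b <= ln (F a) - K * a by lra.
apply: (@nonincreasing_of_second_order R (fun t => F t / F a) (fun t => K * t)
  (fun t => ln (F t) - K * t) a b ab).
- by apply: continuous_subspaceT; exact: mulrl_continuous.
- by move=> u v au uv vb; rewrite ler_pM2r ?invr_gt0 //; exact: (cdf_nd aF uv).
- by move=> u v au uv vb; rewrite ler_wpM2l.
move=> u v au uv vb.
have Fu := pos _ au; have Fv := pos _ (le_trans au uv).
have Fuv := cdf_nd aF uv; have Fau := cdf_nd aF au.
have inc : 1 * (F v - F u) <= K * F v * (v - u).
  apply: (primitive_compare pF (primitive_id R)) => //; first by rewrite mulr_ge0 // ltW.
  move=> t /andP[ut tv]; rewrite mulr1 mul1r.
  have Ft := pos _ (le_trans au (ltW ut)).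
  have := hK t; rewrite (le_trans au (ltW ut)) (le_trans tv vb) => /(_ isT).
  rewrite /rev_hazard ler_pdivrMr // => /le_trans; apply.
  by rewrite ler_wpM2l //; exact: (cdf_nd aF tv).
have lnb := lnB_le Fu Fv.
have d0 : 0 <= K * (v - u) by rewrite mulr_ge0 // subr_ge0.
have : (F v - F u) / F u <= K * (v - u) * ((F v - F u) / F u) + K * (v - u).
  by rewrite ler_pdivrMr // mulrDl mulrA divfK ?gt_eqF //; nra.
have : (F v - F u) / F u <= (F v - F u) / F a.
  by rewrite ler_wpM2l ?subr_ge0 // lef_pV2 ?posrE.
nra.
Qed.

(** Formally, the logarithmic derivative of [F2 / F1] is the difference of the reversed hazard
    rates, which is nonpositive. *)
Lemma cdf_ratio_nonincreasing (R : realType) (F1 f1 F2 f2 : R -> R) (a b : R) :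
  abs_cont_cdf F1 f1 -> abs_cont_cdf F2 f2 -> 0 < F1 a -> 0 < F2 a -> a <= b ->
  (forall t, a <= t <= b -> rev_hazard F2 f2 t <= rev_hazard F1 f1 t) ->
  F2 b / F1 b <= F2 a / F1 a.
Proof.
move=> aF1 aF2 F1a F2a ab hr.
have p1 := abs_cont_cdf_primitive aF1; have p2 := abs_cont_cdf_primitive aF2.
have [_ f10 _] := p1; have [_ f20 _] := p2.
have pos1 t : a <= t -> 0 < F1 t by move=> /(cdf_nd aF1); exact: lt_le_trans.
have pos2 t : a <= t -> 0 < F2 t by move=> /(cdf_nd aF2); exact: lt_le_trans.
apply: (@nonincreasing_of_second_order R (fun t => F1 t / (F1 a * F1 a)) F2
  (fun t => F2 t / F1 t) a b ab).
- exact: (primitive_continuous p2 ab).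
- by move=> u v au uv vb; rewrite ler_pM2r ?invr_gt0 ?mulr_gt0 //; exact: (cdf_nd aF1 uv).
- by move=> u v au uv vb; exact: (cdf_nd aF2 uv).
move=> u v au uv vb.
have av := le_trans au uv.
have F1u := pos1 _ au; have F1v := pos1 _ av.
have F2u := pos2 _ au; have F2v := pos2 _ av.
have F1uv := cdf_nd aF1 uv; have F2uv := cdf_nd aF2 uv.
(* For [u <= t <= v]: [F1 u * f2 t <= F1 t * f2 t <= F2 t * f1 t <= F2 v * f1 t]. *)
have inc : F1 u * (F2 v - F2 u) <= F2 v * (F1 v - F1 u).
  apply: (primitive_compare p2 p1); [exact: ltW|exact: ltW|by []|].
  move=> t /andP[ut tv]; have at_ := le_trans au (ltW ut).
  have F1t := pos1 _ at_; have F2t := pos2 _ at_.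
  have := hr t; rewrite at_ (le_trans tv vb) => /(_ isT).
  rewrite /rev_hazard ler_pdivrMr // mulrAC ler_pdivlMr //.
  have := cdf_nd aF1 (ltW ut); have := cdf_nd aF2 tv.
  have := f10 t; have := f20 t; nra.
(* The new numerator is [F1 u * (F2 v - F2 u) - F2 u * (F1 v - F1 u)], at most the product of the
   increments by [inc]. *)
have -> : F2 v / F1 v - F2 u / F1 u = (F1 u * F2 v - F2 u * F1 v) / (F1 u * F1 v).
  by field; rewrite !gt_eqF.
have ge0 : 0 <= (F1 v - F1 u) * (F2 v - F2 u) by rewrite mulr_ge0 ?subr_ge0.
rewrite -mulrBl mulrAC.
apply: (@le_trans _ _ ((F1 v - F1 u) * (F2 v - F2 u) / (F1 u * F1 v))).
  by rewrite ler_pM2r ?invr_gt0 ?mulr_gt0 //; nra.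
rewrite ler_wpM2l // lef_pV2 ?posrE ?mulr_gt0 // ler_pM ?(ltW F1a) //.
  exact: (cdf_nd aF1 au).
exact: (cdf_nd aF1 av).
Qed.

(** Where both functions are positive, [F2 / F1] is nonincreasing with limit 1 at infinity, hence at
    least 1. *)
Lemma cdf_le_of_rev_hazard (R : realType) (F1 f1 F2 f2 : R -> R) (x : R) :
  abs_cont_cdf F1 f1 -> abs_cont_cdf F2 f2 ->
  (forall t, 0 < t -> 0 < F1 t -> 0 < F2 t -> rev_hazard F2 f2 t <= rev_hazard F1 f1 t) ->
  0 < x -> F1 x <= F2 x.
Proof.
move=> aF1 aF2 hr x0.
have pos2 u : 0 < u -> 0 < F2 u -> F1 u <= F2 u.
  move=> u0 F2u; have [//|F21] := leP (F1 u) (F2 u).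
  have F1u := lt_trans F2u F21.
  have q1 : F2 u / F1 u < 1 by rewrite ltr_pdivrMr // mul1r.
  (* Far out [F2] exceeds the ratio at [u], although there [F2 <= F2 / F1], which is at most that
     ratio. *)
  have [M hM] := cdf_sup1 aF2 q1.
  have uM : u <= Num.max u M by rewrite le_max lexx.
  have := hM (Num.max u M); rewrite le_max lexx orbT => /(_ isT).
  rewrite ltNge => /negP[].
  have F1M := lt_le_trans F1u (cdf_nd aF1 uM).
  apply: le_trans (cdf_ratio_nonincreasing aF1 aF2 F1u F2u uM _).
    rewrite ler_pdivlMr // -[leRHS]mulr1 ler_wpM2l //.
      exact: (abs_cont_cdf_ge0 _ aF2).
    exact: (abs_cont_cdf_le1 _ aF1).
  move=> t /andP[ut _]; apply: hr; first exact: lt_le_trans ut.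
    exact: lt_le_trans (cdf_nd aF1 ut).
  exact: lt_le_trans (cdf_nd aF2 ut).
have [F1x|F1x] := leP (F1 x) 0; first exact: le_trans F1x (abs_cont_cdf_ge0 _ aF2).
have [F2x|F2x] := ltP 0 (F2 x); first exact: pos2.
(* If [F2 x = 0 < F1 x], continuity yields [c >= x] with [F2 c = F1 x / 2], contradicting
   [F1 x <= F1 c <= F2 c]. *)
have h1 : F1 x / 2 < 1 by have := abs_cont_cdf_le1 x aF1; lra.
have [M hM] := cdf_sup1 aF2 h1.
have xM : x <= Num.max x M by rewrite le_max lexx.
have := hM (Num.max x M); rewrite le_max lexx orbT => /(_ isT) F2M.
have [|c + cE] := @IVT _ F2 x (Num.max x M) (F1 x / 2) xM
    (primitive_continuous (abs_cont_cdf_primitive aF2) xM).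
  by rewrite ge_min le_max (ltW F2M) orbT andbT; apply/orP; left; lra.
rewrite in_itv/= => /andP[xc _].
have := pos2 c (lt_le_trans x0 xc); rewrite cE.
have := cdf_nd aF1 xc => h /(_ ltac:(lra)); lra.
Qed.

(** * Archimedean generators and their inverses *)

Section generator.
Variables (R : realType) (n : nat) (psi : R -> R).
Hypothesis gpsi : arch_generator n psi.

Lemma generator_nonincreasing (x y : R) : 0 <= x -> x <= y -> psi y <= psi x.
Proof. by case: gpsi => -[_ + _ _ _ _]; exact. Qed.

Lemma generator_le1 (x : R) : 0 <= x -> 0 <= psi x <= 1.
Proof. by case: gpsi => _ + _ _ _; exact. Qed.

Lemma generator_ivt (x y v : R) : 0 <= x -> x <= y -> psi y <= v <= psi x ->
  exists z, [/\ x <= z, z <= y & psi z = v].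
Proof.
move=> x0 xy hv; have nd := generator_nonincreasing x0 xy.
case: gpsi => -[cpsi _] _ _ _ _.
have [||z] := @IVT _ psi x y v xy.
- apply: continuous_subspaceW cpsi => z /=; rewrite !in_itv/= => /andP[xz _].
  by rewrite andbT (le_trans x0).
- by rewrite min_r // max_l.
- by rewrite in_itv/= => /andP[xz zy] <-; exists z.
Qed.

Lemma gen_inv_ge0 (t : R) : (0 <= gen_inv psi t)%E.
Proof. by apply/ereal_infP => _ [x [x0 _] <-]; rewrite lee_fin. Qed.

Lemma gen_inv_nonincreasing (s t : R) : s <= t -> (gen_inv psi t <= gen_inv psi s)%E.
Proof.
move=> st; apply/ereal_infP => _ [x [x0 xs] <-]; apply: ereal_inf_lbound.
by exists x => //; split => //; exact: le_trans st.
Qed.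

(** If no point has [psi x <= t], the limit 0 of [psi] forces [t = 0]; otherwise continuity makes
    the infimum a point where [psi] equals [t]. *)
Lemma gen_invP (t : R) : 0 <= t -> t <= 1 ->
  (gen_inv psi t = +oo%E /\ t = 0) \/
  exists s, [/\ gen_inv psi t = s%:E, 0 <= s & psi s = t].
Proof.
move=> t0 t1; case: (gpsi) => _ _ psi0 psioo _.
have [[x [x0 xt]]|none] := pselect (exists x, 0 <= x /\ psi x <= t); last first.
  left; split.
    rewrite /gen_inv (_ : [set x | _] = set0) ?image_set0 ?ereal_inf0 //.
    by rewrite -subset0 => x /= hx; apply: none; exists x.
  apply/eqP; rewrite eq_le t0 andbT leNgt; apply/negP => tp.
  have : \forall x \near +oo, psi x < t by exact: (cvgr_lt _ psioo).
  case=> M [_ hM]; apply: none; exists (Num.max 0 M + 1).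
  have M0 : 0 <= Num.max 0 M by rewrite le_max lexx.
  split; first lra.
  by apply/ltW/hM; rewrite (@le_lt_trans _ _ (Num.max 0 M)) ?le_max ?lexx ?orbT //; lra.
right; have [|y [y0 yx yt]] := generator_ivt (lexx 0) x0 (v := t).
  by rewrite xt psi0.
have fin : gen_inv psi t \is a fin_num.
  rewrite ge0_fin_numE ?gen_inv_ge0 // (@le_lt_trans _ _ y%:E) ?ltry //.
  by apply: ereal_inf_lbound; exists y => //; split; rewrite // yt.
exists (fine (gen_inv psi t)); rewrite fineK //; set s := fine _.
have sE : gen_inv psi t = s%:E by rewrite fineK.
have s0 : 0 <= s by rewrite -lee_fin -sE gen_inv_ge0.
have lb z : 0 <= z -> psi z <= t -> s <= z.
  by move=> z0 zt; rewrite -lee_fin -sE; apply: ereal_inf_lbound; exists z.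
have sy : s <= y by apply: lb; rewrite // yt.
split => //; apply/eqP; rewrite eq_le -{2}yt generator_nonincreasing // andbT leNgt.
apply/negP => ts.
(* Were [psi s > t], a point [z] with the midway value would precede every [w] with [psi w <= t]; so
   [z <= s], hence [z = s], which is absurd. *)
have [|z [sz zy zE]] := generator_ivt s0 sy (v := (psi s + t) / 2).
  by rewrite yt; lra.
have : z <= s; last first.
  by move=> zs; move: zE; rewrite (le_anti (introT andP (conj zs sz))); lra.
rewrite -lee_fin -sE; apply/ereal_infP => _ [w [w0 wt] <-]; rewrite lee_fin.
rewrite leNgt; apply/negP => wz.
have := generator_nonincreasing w0 (ltW wz); rewrite zE; lra.
Qed.

Lemma gen_invK (t : R) : 0 <= t -> t <= 1 -> gen_ext psi (gen_inv psi t) = t.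
Proof. by move=> t0 /(gen_invP t0) [[-> ->]|[s [-> _ /= ->]]]. Qed.

Lemma gen_ext_nonincreasing (e e' : \bar R) : (0 <= e)%E -> (e <= e')%E ->
  gen_ext psi e' <= gen_ext psi e.
Proof.
case: e e' => [x||] [y||] //=; rewrite ?lee_fin => x0.
- exact: generator_nonincreasing.
- by move=> _; have /andP[] := generator_le1 x0.
Qed.

Lemma gen_ext_ge0 (e : \bar R) : (0 <= e)%E -> 0 <= gen_ext psi e.
Proof. by case: e => [x||] //=; rewrite lee_fin => /generator_le1 /andP[]. Qed.

(** * Log-convex generators and the two-block inequality *)

Hypothesis lpsi : log_convex psi.

(** A zero at [x] would, by log-convexity on [[0, x]], make [psi] vanish strictly inside, where by
    continuity it takes the value 1/2. *)
Lemma log_convex_generator_gt0 (x : R) : 0 <= x -> 0 < psi x.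
Proof.
move=> x0; rewrite ltNge; apply/negP => px; case: (gpsi) => _ _ psi0 _ _.
have pxE : psi x = 0.
  by apply/eqP; rewrite eq_le px; have /andP[->] := generator_le1 x0.
have [|c [c0 cx cE]] := generator_ivt (lexx 0) x0 (v := 2^-1).
  by rewrite pxE psi0; lra.
have cn0 : c != 0 by apply/eqP => cz; move: cE; rewrite cz psi0; lra.
have cnx : c != x by apply/eqP => cz; move: cE; rewrite cz pxE; lra.
have cp : 0 < c by rewrite lt_neqAle eq_sym cn0.
have cx' : c < x by rewrite lt_neqAle cnx.
have xp : 0 < x by exact: lt_trans cx'.
have cdx : 0 < c / x < 1 by rewrite divr_gt0 //= ltr_pdivrMr // mul1r.
have := @lpsi 0 x (1 - c / x) (lexx 0) x0; rewrite subKr mulr0 add0r divfK ?gt_eqF //.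
rewrite cE pxE powR0 ?mulr0; last by lra.
by move=> /(_ ltac:(lra)); lra.
Qed.

(** Convexity of [ln \o psi] with denominators cleared, so that coinciding points are allowed. *)
Lemma ln_generator_chord (x y z : R) : 0 <= x -> x <= z -> z <= y ->
  ln (psi z) * (y - x) <= ln (psi x) * (y - z) + ln (psi y) * (z - x).
Proof.
move=> x0 xz zy.
have [->|xz'] := eqVneq x z; first by lra.
have [->|zy'] := eqVneq z y; first by lra.
have xz1 : x < z by rewrite lt_neqAle xz'.
have zy1 : z < y by rewrite lt_neqAle zy'.
have d0 : 0 < y - x by lra.
set t := (y - z) / (y - x).
have t01 : 0 < t < 1.
  apply/andP; split; first by apply: divr_gt0; lra.
  by rewrite ltr_pdivrMr // mul1r; lra.
have tE : t * (y - x) = y - z by rewrite divfK // gt_eqF.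
clearbody t.
have zE : z = t * x + (1 - t) * y.
  have -> : t * x + (1 - t) * y = y - t * (y - x) by ring.
  by rewrite tE subKr.
have y0 : 0 <= y by lra.
have px := log_convex_generator_gt0 x0; have py := log_convex_generator_gt0 y0.
have pz := log_convex_generator_gt0 (le_trans x0 xz).
have := lpsi x0 y0 t01; rewrite -zE -ler_ln ?posrE ?mulr_gt0 ?powR_gt0 //.
rewrite lnM ?posrE ?powR_gt0 // !ln_powR => h.
have e2 : (1 - t) * (y - x) = z - x by rewrite mulrBl tE; lra.
rewrite -tE -e2; nra.
Qed.

Lemma gen_inv_gt0_fin (t : R) : 0 < t -> t <= 1 ->
  exists s, [/\ gen_inv psi t = s%:E, 0 <= s & psi s = t].
Proof. by move=> t0 /(gen_invP (ltW t0)) [[_ tz]|//]; move: t0; rewrite tz ltxx. Qed.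

Lemma gen_inv0 : gen_inv psi 0 = +oo%E.
Proof.
have [[]//|[s [_ s0 sE]]] := gen_invP (lexx 0) ler01.
by have := log_convex_generator_gt0 s0; rewrite sE ltxx.
Qed.

(** With [s] and [t] the inverses of [u] and [v], the claim is [b (t2 - s2) <= a (s1 - t1)]. As
    [ln \o psi] is convex and nonincreasing, it falls at least as steeply on [[s2, t2]] as on
    [[t1, s1]], so the bound on logarithms passes to the arguments. *)
Lemma two_block_le (a b : nat) (u1 u2 v1 v2 : R) : (0 < a)%N ->
  0 <= u1 -> u1 <= v1 -> u1 <= v2 -> v1 <= u2 -> v2 <= u2 -> u2 <= 1 ->
  (0 < u1 -> b%:R * (ln u2 - ln v2) <= a%:R * (ln v1 - ln u1)) ->
  gen_ext psi (gen_inv psi u1 *+ a + gen_inv psi u2 *+ b)%E <=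
  gen_ext psi (gen_inv psi v1 *+ a + gen_inv psi v2 *+ b)%E.
Proof.
move=> a0 u10 uv1 uv2 vu1 vu2 u21 hln.
have S0 (t t' : R) : (0 <= gen_inv psi t *+ a + gen_inv psi t' *+ b)%E.
  by rewrite -!mule_natl adde_ge0 // mule_ge0 ?gen_inv_ge0 // lee_fin.
(* For [u1 = 0] the first block is infinite because [a] is positive, and the left side is 0. *)
move: u10; rewrite le_eqVlt => /predU1P[uz|u1p].
  rewrite -uz gen_inv0 -mule_natl gt0_muley ?lte_fin ?ltr0n //.
  rewrite addye ?gen_ext_ge0 //.
  by rewrite -mule_natl -ltNye (@lt_le_trans _ _ 0%E) ?ltNy0 // mule_ge0 ?gen_inv_ge0 ?lee_fin.
have v1p := lt_le_trans u1p uv1; have v2p := lt_le_trans u1p uv2.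
have u2p := lt_le_trans v2p vu2.
have v11 := le_trans vu1 u21; have v21 := le_trans vu2 u21.
have [s1 [s1E s10 ps1]] := gen_inv_gt0_fin u1p (le_trans uv1 v11).
have [s2 [s2E s20 ps2]] := gen_inv_gt0_fin u2p u21.
have [t1 [t1E t10 pt1]] := gen_inv_gt0_fin v1p v11.
have [t2 [t2E t20 pt2]] := gen_inv_gt0_fin v2p v21.
apply: gen_ext_nonincreasing; first exact: S0.
have := gen_inv_nonincreasing uv1; have := gen_inv_nonincreasing uv2.
have := gen_inv_nonincreasing vu1; have := gen_inv_nonincreasing vu2.
rewrite s1E s2E t1E t2E -!mule_natl -!EFinM -!EFinD !lee_fin => st22 st21 ts21 ts11.
have [t2s2|] := leP t2 s2.
  by have := ler0n R a; have := ler0n R b; nra.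
move=> s2t2.
(* Strictness makes [ln u2 - ln v2] positive, so it can be cancelled at the end. *)
have v2u2 : v2 < u2.
  rewrite lt_neqAle vu2 andbT; apply/eqP => e.
  by move: t2E; rewrite e s2E => -[e2]; move: s2t2; rewrite e2 ltxx.
have dln : 0 < ln u2 - ln v2 by rewrite subr_gt0 ltr_ln ?posrE.
have c1 := ln_generator_chord s20 st21 ts11.
have c2 := ln_generator_chord s20 st22 ts21.
move: (hln u1p) c1 c2; rewrite ps1 ps2 pt1 pt2 => {}hln c1 c2.
have d0 : 0 < s1 - s2 by lra.
(* Compare both secant slopes of the convex [ln \o psi] with the one over [[s2, s1]]. *)
have four : (ln v1 - ln u1) * (t2 - s2) <= (ln u2 - ln v2) * (s1 - t1).
  rewrite -(ler_pM2r d0).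
  apply: (@le_trans _ _ ((ln u2 - ln u1) * (s1 - t1) * (t2 - s2))).
    rewrite mulrAC ler_wpM2r //; first lra.
    by rewrite mulrBl; lra.
  by rewrite [leRHS]mulrAC [leLHS]mulrAC ler_wpM2r //; lra.
have : (ln u2 - ln v2) * (b%:R * (t2 - s2)) <= (ln u2 - ln v2) * (a%:R * (s1 - t1)).
  apply: (@le_trans _ _ (a%:R * (ln v1 - ln u1) * (t2 - s2))).
    by rewrite mulrCA mulrA ler_wpM2r //; lra.
  by rewrite -mulrA mulrCA [leRHS]mulrCA mulrCA ler_wpM2l.
rewrite ler_pM2l //; lra.
Qed.

End generator.

(** * Change of generator *)

Lemma gen_ext_superadditive (R : realType) (n m : nat) (psi1 psi2 : R -> R) (u : 'I_m -> R) :
  arch_generator n psi1 -> arch_generator n psi2 ->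
  super_additive (fun x => gen_inv psi2 (psi1 x)) ->
  (forall i, 0 <= u i <= 1) ->
  gen_ext psi1 (\sum_i gen_inv psi1 (u i))%E <= gen_ext psi2 (\sum_i gen_inv psi2 (u i))%E.
Proof.
move=> g1 g2 sup u01.
(* Invariant of the partial sums: the [psi1]-sum is infinite, or it is a real [s] and the [psi2]-sum
   is at most [gen_inv psi2 (psi1 s)]. Super-additivity preserves it under addition. *)
pose K (a b : \bar R) := (0 <= b)%E /\
  (a = +oo%E \/ exists s, [/\ a = s%:E, 0 <= s & (b <= gen_inv psi2 (psi1 s))%E]).
have : K (\sum_i gen_inv psi1 (u i))%E (\sum_i gen_inv psi2 (u i))%E.
  apply: big_ind2 => [|a b a' b' [b0 ab] [b0' ab']|i _].
  - by split => //; right; exists 0; split => //; exact: gen_inv_ge0.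
  - split; first exact: adde_ge0.
    case: ab ab' => [->|[s [-> s0 bs]]] [->|[s' [-> s0' bs']]]; try by left.
    right; exists (s + s'); split => //; first exact: addr_ge0.
    exact: le_trans (leeD bs bs') (sup _ _ s0 s0').
  - split; first exact: gen_inv_ge0.
    have /andP[ui0 ui1] := u01 i.
    have [[-> _]|[s [-> s0 sE]]] := gen_invP g1 ui0 ui1; first by left.
    by right; exists s; split => //; rewrite sE.
case=> b0 [->|[s [-> s0 bs]]] /=; first exact: gen_ext_ge0 g2 _ b0.
have /andP[p0 p1] := generator_le1 g1 s0.
by rewrite -[leLHS](gen_invK g2 p0 p1); exact: (gen_ext_nonincreasing g2).
Qed.

(** * Comparison of scale vectors under one generator *)

Lemma scaled_two_block_le (R : realType) (n a b : nat) (psi F1 f1 F2 f2 : R -> R)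
    (l1 l2 m1 m2 x : R) :
  arch_generator n psi -> log_convex psi -> (0 < a)%N ->
  abs_cont_cdf F1 f1 -> abs_cont_cdf F2 f2 ->
  (forall t, 0 < t -> 0 < F1 t -> 0 < F2 t -> rev_hazard F2 f2 t <= rev_hazard F1 f1 t) ->
  rh_decreasing F1 f1 \/ rh_decreasing F2 f2 ->
  0 < l1 -> l1 <= l2 -> 0 < m1 -> m1 <= m2 ->
  l1 <= m1 -> l1 *+ a + l2 *+ b <= m1 *+ a + m2 *+ b -> 0 < x ->
  gen_ext psi (gen_inv psi (F1 (l1 * x)%R) *+ a + gen_inv psi (F2 (l2 * x)%R) *+ b)%E <=
  gen_ext psi (gen_inv psi (F1 (m1 * x)%R) *+ a + gen_inv psi (F2 (m2 * x)%R) *+ b)%E.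
Proof.
move=> gpsi lpsi a0 aF1 aF2 hr dec l10 l12 m10 m12 lm1 sum_le x0.
have scale (p q : R) : p <= q -> p * x <= q * x by move=> pq; rewrite ler_wpM2r // ltW.
(* If [l2 <= m2], both scales increase and monotonicity suffices. *)
have [lm2|ml2] := leP l2 m2.
  apply: (gen_ext_nonincreasing gpsi).
    by rewrite -!mule_natl adde_ge0 // mule_ge0 ?gen_inv_ge0 // lee_fin.
  rewrite -!mule_natl; apply: leeD.
    by rewrite lee_wpmul2l ?lee_fin //; apply/gen_inv_nonincreasing/(cdf_nd aF1)/scale.
  by rewrite lee_wpmul2l ?lee_fin //; apply/gen_inv_nonincreasing/(cdf_nd aF2)/scale.
have F12 t : 0 < t -> F1 t <= F2 t by exact: (cdf_le_of_rev_hazard aF1 aF2 hr).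
have l1x : 0 < l1 * x by rewrite mulr_gt0.
have m1x : 0 < m1 * x by rewrite mulr_gt0.
have lm1x := scale _ _ lm1; have m12x := scale _ _ m12; have ml2x := scale _ _ (ltW ml2).
apply: (two_block_le gpsi lpsi a0).
- exact: (abs_cont_cdf_ge0 _ aF1).
- exact: (cdf_nd aF1).
- by apply: le_trans (F12 _ l1x) _; apply: (cdf_nd aF2); lra.
- by apply: le_trans (F12 _ m1x) _; apply: (cdf_nd aF2); lra.
- exact: (cdf_nd aF2).
- exact: (abs_cont_cdf_le1 _ aF2).
move=> F1p.
have pos1 t : l1 * x <= t -> 0 < F1 t by move=> /(cdf_nd aF1); exact: lt_le_trans.
have pos2 t : l1 * x <= t -> 0 < F2 t.
  by move=> lt; exact: lt_le_trans (pos1 _ lt) (F12 _ (lt_le_trans l1x lt)).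
(* [K] is the decreasing rate at the end of its interval nearest the other one: the first rate at
   [m1 * x] or the second at [m2 * x]. The ordering of the rates gives the other bound. *)
have [K [K0 Kl Ku]] : exists K, [/\ 0 <= K,
    (forall t, l1 * x <= t <= m1 * x -> K <= rev_hazard F1 f1 t) &
    (forall t, m2 * x <= t <= l2 * x -> rev_hazard F2 f2 t <= K)].
  have [_ f10 _ _ _] := aF1; have [_ f20 _ _ _] := aF2.
  case: dec => dec.
    exists (rev_hazard F1 f1 (m1 * x)); split.
    - by rewrite divr_ge0 // ltW // pos1.
    - move=> t /andP[lt tm]; apply: dec => //; first exact: lt_le_trans lt.
      exact: pos1.
    - move=> t /andP[mt tl].
      have t0 : l1 * x <= t by lra.
      apply: (@le_trans _ _ (rev_hazard F1 f1 t)).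
        by apply: hr; [exact: lt_le_trans t0|exact: pos1|exact: pos2].
      by apply: dec => //; [lra|exact: pos1].
  exists (rev_hazard F2 f2 (m2 * x)); split.
  - by rewrite divr_ge0 // ltW // pos2 //; lra.
  - move=> t /andP[lt tm].
    apply: (@le_trans _ _ (rev_hazard F2 f2 t)).
      by apply: dec; [exact: lt_le_trans lt|lra|exact: pos2].
    by apply: hr; [exact: lt_le_trans lt|exact: pos1|exact: pos2].
  - by move=> t /andP[mt tl]; apply: dec => //; [lra|apply: pos2; lra].
have lower := ln_cdf_lower aF1 F1p lm1x K0 Kl.
have F2p : 0 < F2 (m2 * x) by apply: pos2; lra.
have upper := ln_cdf_upper aF2 F2p ml2x K0 Ku.
apply: (le_trans (ler_wpM2l (ler0n _ b) upper)).
apply: (le_trans _ (ler_wpM2l (ler0n _ a) lower)).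
have -> : b%:R * (K * (l2 * x - m2 * x)) = K * x * (b%:R * (l2 - m2)) by ring.
have -> : a%:R * (K * (m1 * x - l1 * x)) = K * x * (a%:R * (m1 - l1)) by ring.
rewrite ler_wpM2l ?mulr_ge0 ?(ltW x0) //.
by move: sum_le; rewrite -[l1 *+ a]mulr_natl -[l2 *+ b]mulr_natl -[m1 *+ a]mulr_natl
  -[m2 *+ b]mulr_natl; lra.
Qed.

(** * Weak majorization of two-block vectors *)

Lemma sorted_two_blocks (R : realType) (a b : nat) (l1 l2 : R) :
  l1 <= l2 -> sorted <=%R (nseq a l1 ++ nseq b l2).
Proof.
move=> l12; elim: a => [|a ih] /=.
  elim: b => //= b ih.
  by rewrite (path_sortedE le_trans) ih all_nseq lexx orbT.
by rewrite (path_sortedE le_trans) ih all_cat !all_nseq lexx l12 !orbT.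
Qed.

Lemma wsubmaj_two_blocks (R : realType) (a b : nat) (l1 l2 m1 m2 : R) :
  (0 < a)%N -> l1 <= l2 -> m1 <= m2 ->
  wsubmaj (nseq a l1 ++ nseq b l2) (nseq a m1 ++ nseq b m2) ->
  l1 <= m1 /\ l1 *+ a + l2 *+ b <= m1 *+ a + m2 *+ b.
Proof.
move=> a0 l12 m12 [_].
rewrite !(sorted_sort le_trans) ?sorted_two_blocks // size_cat !size_nseq => maj.
split.
  (* The partial sum of length 1 compares the smallest entries; the full one below compares the
     totals. *)
  have := maj 1%N; rewrite !big_ord1 !nth_cat !size_nseq a0 !nth_nseq a0.
  by apply; rewrite addn_gt0 a0.
have total (p q : R) : \sum_(i < a + b) (nseq a p ++ nseq b q)`_i = p *+ a + q *+ b.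
  have sE : (a + b)%N = size (nseq a p ++ nseq b q) by rewrite size_cat !size_nseq.
  by rewrite sE -(big_mkord predT) -(big_nth 0 predT id) big_cat !big_nseq !iter_addr_0.
by have := maj (a + b)%N (leqnn _); rewrite !total.
Qed.

(** Lets case (b) be reduced to case (a) by exchanging the blocks. *)
Lemma wsubmaj_catC (R : realType) (s1 s2 t1 t2 : seq R) :
  wsubmaj (s1 ++ s2) (t1 ++ t2) -> wsubmaj (s2 ++ s1) (t2 ++ t1).
Proof.
have sortC (s t : seq R) : sort <=%R (s ++ t) = sort <=%R (t ++ s).
  by apply/(perm_sortP le_total le_trans le_anti); rewrite perm_catC.
by rewrite /wsubmaj !size_cat (sortC s2) (sortC t2) (addnC (size s2)) (addnC (size t2)).
Qed.

(** * Distribution of the maximum *)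

(** The complement is the joint event at the constant vector [x]; [0 <= x] keeps the seed 0 of the
    maximum harmless. *)
Lemma max_tail (R : realType) (d : measure_display) (T : measurableType d)
    (P : probability T R) (m : nat) (Z : 'I_m -> {RV P >-> R}) (G : 'I_m -> R -> R)
    (psi : R -> R) (x : R) :
  shares_arch_copula Z G psi -> 0 <= x ->
  P [set w | x < maxRV (fun i => Z i : T -> R) w] =
  (1 - gen_ext psi (\sum_i gen_inv psi (G i x))%E)%:E.
Proof.
move=> copZ x0.
have -> : [set w | x < maxRV (fun i => Z i : T -> R) w] = ~` [set w | forall i, Z i w <= x].
  rewrite predeqE => w /=; rewrite ltNge; split.
    by move=> /negP h hZ; apply: h; apply/bigmax_leP; split.
  by move=> h; apply/negP => /bigmax_leP[_ hZ]; apply: h => i; exact: hZ.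
rewrite probability_setC; last first.
  rewrite (_ : [set w | _] = \bigcap_(i in setT) (Z i @^-1` `]-oo, x])).
    apply: fin_bigcap_measurable => // i _; rewrite -[_ @^-1` _]setTI.
    exact: measurable_funP.
  by rewrite predeqE => w /=; split => [h i _|h i] /=; [rewrite in_itv/=|have := h i I; rewrite /= in_itv].
by rewrite (copZ (fun=> x)) EFinB.
Qed.

Lemma sum_two_blocks (R : realType) (a b : nat) (u v : \bar R) :
  (\sum_(i < a + b) if (i < a)%N then u else v)%E = (u *+ a + v *+ b)%E.
Proof.
rewrite big_split_ord /=; congr (_ + _)%E.
  by under eq_bigr do rewrite ltn_ord; rewrite sumr_const card_ord.
by under eq_bigr do rewrite ltnNge leq_addr /=; rewrite sumr_const card_ord.
Qed.
Theorem theorem3p1 (R : realType) (n1 n2 : nat)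
  (F1 F2 f1 f2 psi1 psi2 : R -> R)
  (lam1 lam2 mu1 mu2 : R)
  (d1 d2 : measure_display) (T1 : measurableType d1) (T2 : measurableType d2)
  (P1 : probability T1 R) (P2 : probability T2 R)
  (X : 'I_(n1 + n2) -> {RV P1 >-> R}) (Y : 'I_(n1 + n2) -> {RV P2 >-> R}) :
  (1 <= n1)%N -> (1 <= n2)%N ->
  abs_cont_cdf F1 f1 -> abs_cont_cdf F2 f2 ->
  arch_generator (n1 + n2) psi1 -> arch_generator (n1 + n2) psi2 ->
  0 < lam1 -> 0 < lam2 -> 0 < mu1 -> 0 < mu2 ->
  (forall i w, 0 <= X i w) -> (forall i w, 0 <= Y i w) ->
  shares_arch_copula X
    (fun i x => if (i < n1)%N then F1 (lam1 * x) else F2 (lam2 * x)) psi1 ->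
  shares_arch_copula Y
    (fun i x => if (i < n1)%N then F1 (mu1 * x) else F2 (mu2 * x)) psi2 ->
  (forall i x, P1 [set w | X i w <= x] =
     (if (i < n1)%N then F1 (lam1 * x) else F2 (lam2 * x))%:E) ->
  (forall i x, P2 [set w | Y i w <= x] =
     (if (i < n1)%N then F1 (mu1 * x) else F2 (mu2 * x))%:E) ->
  super_additive (fun x => gen_inv psi2 (psi1 x)) ->
  log_convex psi1 \/ log_convex psi2 ->
  rh_decreasing F1 f1 \/ rh_decreasing F2 f2 ->
  ((forall x, 0 < x -> 0 < F1 x -> 0 < F2 x -> rev_hazard F1 f1 x >= rev_hazard F2 f2 x)
     /\ (n1 >= n2)%N /\ 0 < lam1 <= lam2 /\ 0 < mu1 <= mu2)
  \/
  ((forall x, 0 < x -> 0 < F1 x -> 0 < F2 x -> rev_hazard F1 f1 x <= rev_hazard F2 f2 x)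
     /\ (n1 <= n2)%N /\ 0 < lam2 <= lam1 /\ 0 < mu2 <= mu1) ->
  wsubmaj (nseq n1 lam1 ++ nseq n2 lam2) (nseq n1 mu1 ++ nseq n2 mu2) ->
  st_le P2 P1 (maxRV (fun i => Y i : T2 -> R)) (maxRV (fun i => X i : T1 -> R)).
Proof.
move=> n1p n2p aF1 aF2 g1 g2 l1p l2p m1p m2p X0 Y0 cX cY _ _ sup lc dec hyp maj x.
(* For negative [x] both tails are 1, since a maximum is at least its seed 0. *)
have [x0|x0] := ltP x 0.
  have -> : [set w | x < maxRV (fun i => X i : T1 -> R) w] = setT.
    by rewrite predeqE => w; split=> // _ /=; apply: (lt_le_trans x0); exact: bigmax_ge_id.
  rewrite probability_setT.
  rewrite (_ : [set w | _] = setT) ?probability_setT //.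
  by rewrite predeqE => w; split=> // _ /=; apply: (lt_le_trans x0); exact: bigmax_ge_id.
rewrite (max_tail cX x0) (max_tail cY x0) lee_fin lerB //.
have sumE psi c1 c2 : (\sum_(i < n1 + n2) gen_inv psi
    (if (i < n1)%N then F1 (c1 * x)%R else F2 (c2 * x)%R))%E =
    (gen_inv psi (F1 (c1 * x)%R) *+ n1 + gen_inv psi (F2 (c2 * x)%R) *+ n2)%E.
  by rewrite -sum_two_blocks; apply: eq_bigr => i _; case: ifP.
have cross c1 c2 := gen_ext_superadditive (u := fun i : 'I_(n1 + n2) =>
  if (i < n1)%N then F1 (c1 * x) else F2 (c2 * x)) g1 g2 sup.
have u01 c1 c2 (i : 'I_(n1 + n2)) : 0 <= (if (i < n1)%N then F1 (c1 * x) else F2 (c2 * x)) <= 1.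
  by case: ifP => _; rewrite ?(abs_cont_cdf_ge0 _ aF1) ?(abs_cont_cdf_ge0 _ aF2)
     ?(abs_cont_cdf_le1 _ aF1) ?(abs_cont_cdf_le1 _ aF2).
have same psi : arch_generator (n1 + n2) psi -> log_convex psi ->
    gen_ext psi (\sum_(i < n1 + n2) gen_inv psi
      (if (i < n1)%N then F1 (lam1 * x)%R else F2 (lam2 * x)%R))%E <=
    gen_ext psi (\sum_(i < n1 + n2) gen_inv psi
      (if (i < n1)%N then F1 (mu1 * x)%R else F2 (mu2 * x)%R))%E.
  move=> gpsi lpsi; move: x0; rewrite le_eqVlt => /predU1P[<-|xp].
    by rewrite !mulr0.
  rewrite !sumE; case: hyp => -[hr [_ [/andP[_ l12] /andP[_ m12]]]].
    have [lm1 tot] := wsubmaj_two_blocks n1p l12 m12 maj.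
    exact: (scaled_two_block_le gpsi lpsi n1p aF1 aF2).
  have [lm2 tot] := wsubmaj_two_blocks n2p l12 m12 (wsubmaj_catC maj).
  (* Case (b): the blocks, and with them [F1] and [F2], exchange roles. *)
  rewrite addeC [in leRHS]addeC.
  apply: (scaled_two_block_le gpsi lpsi n2p aF2 aF1) => //; last by case: dec; [right|left].
  by move=> t t0 F2t F1t; exact: hr.
(* The scales are changed under the log-convex generator: before the change of generator if it is
   [psi1], after it if it is [psi2]. *)
case: lc => lc.
  by apply: le_trans (same _ g1 lc) _; exact: cross.
by apply: le_trans (same _ g2 lc); exact: cross.
Qed.
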